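(* Let $\mathcal A$ and $\mathcal B$ be ideals of closed subsets of a topological space $X$ and suppose that $X$ is $\mathcal A$-normal. Then $$\mathcal G := \mathsf G_1(\mathcal O_X(\mathcal A), \mathcal O_X(\mathcal B)) \equiv \mathsf G_1(\Omega_{MU_{\mathcal A}(X),\mathbf 0},\Omega_{MU_{\mathcal B}(X),\mathbf 0}) \equiv \mathsf G_1(\mathscr D_{MU_{\mathcal A}(X)},\Omega_{MU_{\mathcal B}(X),\mathbf 0}),$$ $$\mathcal H := \mathsf G_1(\mathscr N_X[\mathcal A], \neg \mathcal O_X(\mathcal B)) \equiv \mathsf G_1(\mathscr N_{MU_{\mathcal A}(X),\mathbf 0}, \neg \Omega_{MU_{\mathcal B}(X),\mathbf 0}) \equiv \mathsf G_1(\mathscr T_{MU_{\mathcal A}(X)}, \neg \Omega_{MU_{\mathcal B}(X),\mathbf 0}),$$ and $\mathcal G$ is dual to $\mathcal H$. If $X$ is functionally $\mathcal A$-normal, then $$\mathsf G_1(\mathcal O_X(\mathcal A), \mathcal O_X(\mathcal B)) \equiv \mathsf G_1(\Omega_{MU_{\mathcal A}(X),\mathbf 0},\Omega_{MU_{\mathcal B}(X),\mathbf 0}) \equiv \mathsf G_1(\Omega_{C_{\mathcal A}(X),\mathbf 0},\Omega_{C_{\mathcal B}(X),\mathbf 0}) \equiv \mathsf G_1(\mathscr D_{MU_{\mathcal A}(X)},\Omega_{MU_{\mathcal B}(X),\mathbf 0}) \equiv \mathsf G_1(\mathscr D_{C_{\mathcal A}(X)},\Omega_{C_{\mathcal B}(X),\mathbf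 0})$$ and $$\mathsf G_1(\mathscr N_X[\mathcal A], \neg \mathcal O_X(\mathcal B)) \equiv \mathsf G_1(\mathscr N_{MU_{\mathcal A}(X),\mathbf 0}, \neg \Omega_{MU_{\mathcal B}(X),\mathbf 0}) \equiv \mathsf G_1(\mathscr N_{C_{\mathcal A}(X),\mathbf 0}, \neg \Omega_{C_{\mathcal B}(X),\mathbf 0}) \equiv \mathsf G_1(\mathscr T_{MU_{\mathcal A}(X)}, \neg \Omega_{MU_{\mathcal B}(X),\mathbf 0}) \equiv \mathsf G_1(\mathscr T_{C_{\mathcal A}(X)}, \neg \Omega_{C_{\mathcal B}(X),\mathbf 0}).$$
   Context: Games. For collections $\mathcal P,\mathcal Q$ of sets, in the game $\mathsf G_1(\mathcal P,\mathcal Q)$, at round $n\in\omega$ One chooses $P_n\in\mathcal P$ and Two responds with $x_n\in P_n$; Two wins if $\{x_n:n\in\omega\}\in\mathcal Q$, otherwise One wins. $\neg\mathcal Q$ denotes the collection of sets not in $\mathcal Q$. A strategy for One is $\sigma:(\bigcup\mathcal P)^{<\omega}\to\mathcal P$; it is winning if $\{x_n:n\in\omega\}\notin\mathcal Q$ whenever $x_n\in\sigma\langle x_k:k<n\rangle$ for all $n$; $\mathrm I\uparrow$ means One has a winning strategy. A strategy for Two is $\tau:\mathcal P^{<\omega}\to\bigcup\mathcal P$ (giving legal moves); it is winning if $\{\tau(P_0,\dots,P_n):n\in\omega\}\in\mathcal Q$ for all $(P_n)\in\mathcal P^\omega$; $\mathrm{II}\uparrow$ means Two has a winning strategy. A predetermined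 strategy for One is a function $\omega\to\mathcal P$ (depends only on the round); $\mathrm I\underset{\mathrm{pre}}{\uparrow}$ means One has a winning one. A Markov strategy for Two is a function $\mathcal P\times\omega\to\bigcup\mathcal P$ (depends only on One's latest move and the round); $\mathrm{II}\underset{\mathrm{mark}}{\uparrow}$ means Two has a winning one. Games $\mathcal G,\mathcal H$ are equivalent, $\mathcal G\equiv\mathcal H$, if $\mathrm{II}\underset{\mathrm{mark}}{\uparrow}\mathcal G\Leftrightarrow\mathrm{II}\underset{\mathrm{mark}}{\uparrow}\mathcal H$; $\mathrm{II}\uparrow\mathcal G\Leftrightarrow\mathrm{II}\uparrow\mathcal H$; $\mathrm I\not\uparrow\mathcal G\Leftrightarrow\mathrm I\not\uparrow\mathcal H$; and $\mathrm I\underset{\mathrm{pre}}{\not\uparrow}\mathcal G\Leftrightarrow\mathrm I\underset{\mathrm{pre}}{\not\uparrow}\mathcal H$. They are dual if $\mathrm I\uparrow\mathcal G\Leftrightarrow\mathrm{II}\uparrow\mathcal H$; $\mathrm{II}\uparrow\mathcal G\Leftrightarrow\mathrm I\uparrow\mathcal H$; $\mathrm I\underset{\mathrm{pre}}{\uparrow}\mathcal G\Leftrightarrow\mathrm{II}\underset{\mathrm{mark}}{\uparrow}\mathcal H$; and $\mathrm{II}\underset{\mathrm{mark}}{\uparrow}\mathcal G\Leftrightarrow\mathrm I\underset{\mathrm{pre}}{\uparrow}\mathcal H$. Ideals and covers. An ideal of closed subsets of $X$ is a family $\mathcal A$ of non-empty closed subsets of $X$, closed under unions of two members and containing $\{x\}$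 for every $x\in X$; throughout, $X\notin\mathcal A$ is assumed for every ideal of closed sets. $X$ is $\mathcal A$-normal if for every $A\in\mathcal A$ and open $U\supseteq A$ there is an open $V$ with $A\subseteq V\subseteq\mathrm{cl}(V)\subseteq U$. $X$ is functionally $\mathcal A$-normal if for every $A\in\mathcal A$ and open $U\supseteq A$ there is a continuous $f:X\to\mathbb R$ with $f[A]=\{0\}$ and $f[X\setminus U]=\{1\}$ (i.e. $f=1$ on $X\setminus U$). $\mathcal O_X(\mathcal A)$ is the set of $\mathcal A$-covers: open covers $\mathscr U$ of $X$ with $\emptyset,X\notin\mathscr U$ such that every $A\in\mathcal A$ is contained in some $U\in\mathscr U$. For a space $Z$: $\mathscr T_Z$ is the family of proper non-empty open subsets of $Z$; $\mathscr N_{Z,z}=\{U\in\mathscr T_Z:z\in U\}$; $\mathscr N_Z(A)=\{U\in\mathscr T_Z:A\subseteq U\}$; $\mathscr N_Z[\mathcal A]=\{\mathscr N_Z(A):A\in\mathcal A\}$ (so in $\mathsf G_1(\mathscr N_X[\mathcal A],\cdot)$ One in effect plays $A\in\mathcal A$ and Two a proper open $U\supseteq A$); $\mathscr D_Z$ is the set of dense subsets of $Z$; $\Omega_{Z,z}=\{S\subseteq Z: z\in\mathrm{cl}(S)\}$. Minimal usco maps. An usco map $\Phi$ from $X$ to $\mathbb R$ assigns to each $x\in X$ a non-empty compact set $\Phi(x)\subseteq\mathbb R$ so that $\{x:\Phi(x)\subseteq V\}$ is open for every open $V\subseteq\mathbb R$; it is minimal if its graph $\{(x,y):y\in\Phi(x)\}$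 is $\subseteq$-minimal among graphs of usco maps from $X$ to $\mathbb R$. $MU(X)$ is the set of minimal usco maps from $X$ to $\mathbb R$. For $\Phi\in MU(X)$, $A\subseteq X$, $\varepsilon>0$, $[\Phi;A,\varepsilon]$ is the set of $\Psi\in MU(X)$ such that for all $x\in A$ each point of $\Phi(x)$ is within distance $<\varepsilon$ of some point of $\Psi(x)$ and each point of $\Psi(x)$ is within distance $<\varepsilon$ of some point of $\Phi(x)$. $MU_{\mathcal A}(X)$ is $MU(X)$ with the topology in which $O$ is open iff for each $\Phi\in O$ there are $A\in\mathcal A$, $\varepsilon>0$ with $[\Phi;A,\varepsilon]\subseteq O$. $C_{\mathcal A}(X)$ is the set of continuous functions $X\to\mathbb R$ with the topology of uniform convergence on members of $\mathcal A$ (basic neighborhoods of $f$: $\{g:|f(x)-g(x)|<\varepsilon\ \forall x\in A\}$, $A\in\mathcal A$, $\varepsilon>0$). $\mathbf 0$ denotes the constant map $x\mapsto\{0\}$ in $MU(X)$ and the constant function $0$ in $C_{\mathcal A}(X)$. *)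

(* Defs.v *)
From HB Require Import structures.
From mathcomp Require Import all_boot all_order all_algebra.
From mathcomp Require Import all_classical all_reals all_analysis.

Set Implicit Arguments.
Unset Strict Implicit.
Unset Printing Implicit Defensive.

Import Order.TTheory GRing.Theory Num.Theory.
Import numFieldNormedType.Exports.
Local Open Scope classical_set_scope.
Local Open Scope ring_scope.

(* [G1 P Q] is the single-selection game in which One plays members of [P],
   Two picks a point of the set just played, and Two wins when the set of the
   points picked belongs to [Q]. *)
Record game := G1 {
  game_point : Type;
  game_moves : set (set game_point);
  game_goal : set (set game_point) }.
Arguments G1 {game_point}.

Section Strategies.
Variable G : game.
Let T := game_point G.
Let P : set (set T) := @game_moves G.
Let Q : set (set T) := @game_goal G.

(* Strategies are total functions on finite histories, listed oldest first;
   only their values on histories with entries in [\bigcup P], respectively in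
   [P], are constrained. [mkseq x n] is the sequence x_0, ..., x_(n-1). *)
Definition I_wins : Prop :=
  exists sigma : seq T -> set T,
    (forall s : seq T,
       all (fun x => x \in \bigcup_(p in P) p) s -> P (sigma s)) /\
    (forall x : nat -> T,
       (forall n, sigma (mkseq x n) (x n)) -> ~ Q (range x)).

Definition II_wins : Prop :=
  exists tau : seq (set T) -> T,
    (forall (s : seq (set T)) (p : set T),
       all (fun q => q \in P) s -> P p -> p (tau (rcons s p))) /\
    (forall p : nat -> set T,
       (forall n, P (p n)) -> Q (range (fun n => tau (mkseq p n.+1)))).

Definition I_pre_wins : Prop :=
  exists p : nat -> set T,
    (forall n, P (p n)) /\
    (forall x : nat -> T, (forall n, p n (x n)) -> ~ Q (range x)).

Definition II_mark_wins : Prop :=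
  exists tau : set T -> nat -> T,
    (forall p n, P p -> p (tau p n)) /\
    (forall p : nat -> set T,
       (forall n, P (p n)) -> Q (range (fun n => tau (p n) n))).

End Strategies.

Definition game_equiv (G H : game) : Prop :=
  [/\ II_mark_wins G <-> II_mark_wins H,
      II_wins G <-> II_wins H,
      ~ I_wins G <-> ~ I_wins H &
      ~ I_pre_wins G <-> ~ I_pre_wins H].

Definition game_dual (G H : game) : Prop :=
  [/\ I_wins G <-> II_wins H,
      II_wins G <-> I_wins H,
      I_pre_wins G <-> II_mark_wins H &
      II_mark_wins G <-> I_pre_wins H].

(* [ideal_nonempty] only excludes the empty space. *)
Record closed_ideal (X : topologicalType) := ClosedIdeal {
  ideal_mem :> set (set X);
  ideal_nonempty : ideal_mem !=set0;
  ideal_closed : forall A, ideal_mem A -> closed A;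
  ideal_neq0 : forall A, ideal_mem A -> A !=set0;
  idealU : forall A B, ideal_mem A -> ideal_mem B -> ideal_mem (A `|` B);
  ideal1 : forall x, ideal_mem [set x];
  ideal_neqT : ~ ideal_mem [set: X] }.

Section Normality.
Variables (R : realType) (X : topologicalType) (AA : closed_ideal X).

Definition ideal_normal : Prop :=
  forall A U : set X, ideal_mem AA A -> open U -> A `<=` U ->
  exists V : set X, [/\ open V, A `<=` V, V `<=` closure V & closure V `<=` U].

Definition functionally_ideal_normal : Prop :=
  forall A U : set X, ideal_mem AA A -> open U -> A `<=` U ->
  exists f : X -> R,
    [/\ continuous f, f @` A = [set 0] & forall x, ~ U x -> f x = 1].

End Normality.

Section Families.
Variable Z : topologicalType.

Definition proper_opens : set (set Z) :=
  [set U | [/\ open U, U !=set0 & U <> [set: Z]]].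

Definition proper_nbhs_pt (z : Z) : set (set Z) :=
  [set U | proper_opens U /\ U z].

Definition proper_nbhs_set (A : set Z) : set (set Z) :=
  [set U | proper_opens U /\ A `<=` U].

Definition proper_nbhs_fam (AA : set (set Z)) : set (set (set Z)) :=
  [set proper_nbhs_set A | A in AA].

Definition dense_sets : set (set Z) := [set S | dense S].

Definition Omega_pt (z : Z) : set (set Z) := [set S | closure S z].

Definition ideal_covers (AA : set (set Z)) : set (set (set Z)) :=
  [set UU | [/\ UU `<=` open,
                \bigcup_(U in UU) U = [set: Z],
                ~ UU set0,
                ~ UU [set: Z] &
                forall A, AA A -> exists2 U, UU U & A `<=` U]].

End Families.

Section MinimalUsco.
Variables (R : realType) (X : topologicalType).

Definition usco (Phi : X -> set R) : Prop :=
  (forall x, Phi x !=set0 /\ compact (Phi x)) /\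
  (forall V : set R, open V -> open [set x | Phi x `<=` V]).

Definition graph (Phi : X -> set R) : set (X * R) :=
  [set xy | Phi xy.1 xy.2].

Definition minimal_usco (Phi : X -> set R) : Prop :=
  usco Phi /\
  forall Psi, usco Psi -> graph Psi `<=` graph Phi -> graph Psi = graph Phi.

Record MU := MkMU { MU_fun :> X -> set R; MU_minimal : minimal_usco MU_fun }.

HB.instance Definition _ := gen_eqMixin MU.
HB.instance Definition _ := gen_choiceMixin MU.

Lemma minimal_usco0 : minimal_usco (fun=> [set 0]).
Proof.
split=> [|Psi [Psi0 _] sub].
  split=> [x|V _]; first by split; [exists 0|exact: compact_set1].
  have [V0|V0] := pselect (V 0).
    rewrite (_ : mkset _ = setT); first exact: openT.
    by apply/seteqP; split=> // x _ y /= ->.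
  rewrite (_ : mkset _ = set0); first exact: open0.
  by apply/seteqP; split=> // x /= /(_ 0 erefl).
apply/seteqP; split=> // -[x y] yx.
have [[z Psiz] _] := Psi0 x.
have z0 : z = 0 := sub (x, z) Psiz.
have y0 : y = 0 := yx.
by rewrite /graph /= y0 -z0.
Qed.

Definition MU0 : MU := MkMU minimal_usco0.

Definition MU_ball (Phi : MU) (A : set X) (e : R) : set MU :=
  [set Psi | forall x, A x ->
     (forall y, Phi x y -> exists2 z, Psi x z & `|y - z| < e) /\
     (forall z, Psi x z -> exists2 y, Phi x y & `|z - y| < e)].

(* The underlying set of [MU_on AA] does not depend on [AA]; the index only
   selects the topology. The same encoding is used for [C_on]. *)
Definition MU_on (AA : closed_ideal X) : Type := MU.

Section Topology.
Variable AA : closed_ideal X.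

HB.instance Definition _ := Choice.on (MU_on AA).

Definition MU_open (O : set (MU_on AA)) : Prop :=
  forall Phi, O Phi ->
  exists A (e : R), [/\ ideal_mem AA A, 0 < e & MU_ball Phi A e `<=` O].

Let MU_openT : MU_open setT.
Proof. by move=> Phi _; have [A AAA] := ideal_nonempty AA; exists A, 1. Qed.

Let MU_openI : setI_closed MU_open.
Proof.
move=> O1 O2 op1 op2 Phi [/op1[A [e [AAA e0 sub1]]] /op2[B [d [AAB d0 sub2]]]].
exists (A `|` B), (Num.min e d); split; [exact: idealU|by rewrite lt_min e0|].
move=> Psi h; split; [apply: sub1|apply: sub2] => x xAB.
- have [h1 h2] := h x (or_introl xAB).
  split=> [y /h1[z ? lt]|z /h2[y ? lt]]; [exists z|exists y] => //;
    by move: lt; rewrite lt_min => /andP[].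
- have [h1 h2] := h x (or_intror xAB).
  split=> [y /h1[z ? lt]|z /h2[y ? lt]]; [exists z|exists y] => //;
    by move: lt; rewrite lt_min => /andP[].
Qed.

Let MU_open_bigU (I : Type) (f : I -> set (MU_on AA)) :
  (forall i, MU_open (f i)) -> MU_open (\bigcup_i f i).
Proof.
move=> opf Phi [i _ /opf[A [e [AAA e0 sub]]]].
by exists A, e; split=> // Psi /sub; exists i.
Qed.

HB.instance Definition _ :=
  isOpenTopological.Build (MU_on AA) MU_openT MU_openI MU_open_bigU.

Lemma MU_openE : @open (MU_on AA) = MU_open.
Proof. by []. Qed.

End Topology.
End MinimalUsco.
Arguments MU0 {R X}.

Section ContinuousFunctions.
Variables (R : realType) (X : topologicalType).

Definition C_on (AA : closed_ideal X) : Type := continuousType X R.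

Definition C0 : continuousType X R := [the continuousType X R of cst 0].

Section Topology.
Variable AA : closed_ideal X.

HB.instance Definition _ := Choice.on (C_on AA).
HB.instance Definition _ := Topological.copy (C_on AA)
  (initial_topology (id : continuousType X R -> {family (ideal_mem AA), X -> R})).

(* The topology of [C_on AA] has the expected neighbourhood bases. *)
Lemma C_nbhsP (f : C_on AA) (N : set (C_on AA)) :
  nbhs f N <->
  exists A (e : R), [/\ ideal_mem AA A, 0 < e &
    [set g : continuousType X R |
       forall x, A x -> `|(f : continuousType X R) x - g x| < e] `<=` N].
Proof.
pose D := [set Ae : set X * R | ideal_mem AA Ae.1 /\ 0 < Ae.2].
pose f' : X -> R := (f : continuousType X R).
pose b (Ae : set X * R) :=
  [set g : X -> R | forall x, Ae.1 x -> `|f' x - g x| < Ae.2].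
have FF : Filter (filter_from D b).
  apply: filter_from_filter.
    by have [A AAA] := ideal_nonempty AA; exists (A, 1).
  move=> [A e] [B d] [/= AAA e0] [/= AAB d0].
  exists (A `|` B, Num.min e d).
    by split=> /=; [exact: idealU|rewrite lt_min e0].
  move=> g h; split=> x xAB.
    by have := h x (or_introl xAB); rewrite lt_min => /andP[].
  by have := h x (or_intror xAB); rewrite lt_min => /andP[].
have cvgb : {family (ideal_mem AA), filter_from D b --> f'}.
  apply/fam_cvgP => A AAA P /uniform_nbhs[E [entE EP]].
  move: entE; rewrite -entourage_ballE => -[e /= e0 eE].
  by exists (A, e) => // g bg; apply: EP => x Ax; apply: eE; exact: bg.
split=> [[_ [[W oW <-] Wf WN]]|[A [e [AAA e0 AeN]]]].
  have /cvgb[[A e] [/= AAA e0] bW] :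
    nbhs (f' : {family (ideal_mem AA), X -> R}) W by exact: open_nbhs_nbhs.
  by exists A, e; split=> // g fg; apply: WN; apply: bW.
have fN := @fam_nbhs _ _ (ideal_mem AA) A _
  (f' : {family (ideal_mem AA), X -> R}) (@entourage_ball R R (PosNum e0)) AAA.
apply: filterS AeN _.
exact: (@initial_continuous _ {family (ideal_mem AA), X -> R}
  (id : continuousType X R -> {family (ideal_mem AA), X -> R}) f _ fN).
Qed.

End Topology.
End ContinuousFunctions.
Arguments C0 {R X}.

(* Main.v *)
Require Import Defs.
From mathcomp Require Import all_boot all_order all_algebra.
From mathcomp Require Import all_classical all_reals all_analysis.
From mathcomp Require Import lra.

(** Two ideas reduce the whole corollary to one construction.

    Duality.  Suppose that the members of [P] meet all members of [M], and that
    every choice function on [M] has its range in [P].  Then the game in which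
    One plays from [P] and the game in which One plays from [M], with the
    complementary goal, are dual ([dual_of_selection]).  Covers are paired in
    this way with neighbourhoods of members of the ideal, sets accumulating at
    a point with its neighbourhoods, dense sets with open sets.  The
    equivalences between the neighbourhood games therefore follow from those
    between the covering games.

    Translation.  If the moves of One in a game [H] can be turned, round by
    round, into moves of One in [G], and the answers of Two in [G] back into
    answers in [H] without spoiling a victory of Two, then all four statements
    defining equivalence pass from [G] to [H]; write [game_le G H]
    ([game_le_translation]).  The covering games are equivalent because of a
    cycle, which is the same for minimal usco maps and for continuous
    functions:
      covers <= sets accumulating at 0 <= dense sets <= covers.
    - First step ([covers_le_adheres0]): in round [n] a set [S] accumulating
      at 0 becomes the cover by the proper open sets on which some member of
      [S] is smaller than [1 / (n + 1)].  If Two picks a cover, each member of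
      the ideal is caught in arbitrarily late rounds, because no set of the
      cover is the whole space, so the functions picked accumulate at 0.
    - Second step: a dense set accumulates at 0, so One has fewer moves.
    - Third step ([dense_le_covers]): a cover becomes the set of functions that
      are nowhere small outside some set of the cover.  If the functions picked
      accumulate at 0, one of them is small on a given member of the ideal,
      which therefore lies in the set of the cover that goes with it.

    Only the third step needs normality, to see that these functions are dense:
    a function [f] has to be modified to avoid the values near 0 off an open
    [U], without changing it on a set [A] of the ideal inside [U].  For
    continuous functions [f * (1 - h) + h] does it, with [h] separating [A] from
    the complement of [U] ([C_dense_big]).  For minimal usco maps, take an open
    [V] containing [A] with closure inside [U], and glue the given map on [V]
    to the constant 1 off the closure of [V] ([minimal_usco_glue]). *)

Set Implicit Arguments.
Unset Strict Implicit.
Unset Printing Implicit Defensive.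

Import Order.TTheory GRing.Theory Num.Theory.
Import numFieldNormedType.Exports.
Local Open Scope classical_set_scope.

(** * Selection games *)

Definition game_le (G H : game) : Prop :=
  [/\ II_mark_wins G -> II_mark_wins H,
      II_wins G -> II_wins H,
      I_wins H -> I_wins G &
      I_pre_wins H -> I_pre_wins G].

Lemma game_le_equiv G H : game_le G H -> game_le H G -> game_equiv G H.
Proof. by move=> [? ? ? ?] [? ? ? ?]; split; split=> //; apply: contra_not. Qed.

Lemma game_le_trans G H K : game_le G H -> game_le H K -> game_le G K.
Proof. by move=> [? ? ? ?] [? ? ? ?]; split; tauto. Qed.

Lemma game_equiv_sym G H : game_equiv G H -> game_equiv H G.
Proof. by case=> *; split; tauto. Qed.

Lemma game_equiv_trans G H K :
  game_equiv G H -> game_equiv H K -> game_equiv G K.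
Proof. by move=> [? ? ? ?] [? ? ? ?]; split; tauto. Qed.

Lemma game_equiv_dual G G' H H' :
  game_dual G H -> game_dual G' H' -> game_equiv G G' -> game_equiv H H'.
Proof.
move=> [d1 d2 d3 d4] [e1 e2 e3 e4] [m w /iff_not2 i /iff_not2 p].
by split; rewrite ?iff_not2; tauto.
Qed.

Section Transcript.
Variables (T U : Type) (g : seq U -> T -> U).

(** Strategies are transferred between games by replaying a history: the moves
    that the other game would have seen are rebuilt one by one, each from those
    rebuilt before it. *)
Definition transcript : seq T -> seq U :=
  foldl (fun acc x => rcons acc (g acc x)) [::].

Lemma transcript_rcons s x :
  transcript (rcons s x) = rcons (transcript s) (g (transcript s) x).
Proof. by rewrite /transcript -cats1 foldl_cat. Qed.

Lemma size_transcript s : size (transcript s) = size s.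
Proof.
by elim/last_ind: s => // s x IH; rewrite transcript_rcons !size_rcons IH.
Qed.

Lemma transcript_mkseq (x : nat -> T) n :
  transcript (mkseq x n) =
  mkseq (fun i => g (transcript (mkseq x i)) (x i)) n.
Proof. by elim: n => // n IH; rewrite mkseqS transcript_rcons mkseqS -IH. Qed.

End Transcript.

(** A play that follows the strategy never leaves [\bigcup_(p in P) p], so on
    other histories the strategy may answer with its opening move. *)
Lemma I_wins_total T (P Q : set (set T)) :
  I_wins (G1 P Q) <->
  exists2 sigma : seq T -> set T, (forall s, P (sigma s)) &
    forall x : nat -> T,
      (forall n, sigma (mkseq x n) (x n)) -> ~ Q (range x).
Proof.
split=> [[sigma [/= legal win]]|[sigma legal win]]; last first.
  by exists sigma; split=> /= [s _|x]; [exact: legal|exact: win].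
pose ok (s : seq T) := all (fun x => x \in \bigcup_(p in P) p) s.
exists (fun s => if ok s then sigma s else sigma [::]) => [s|x xs].
  by case: ifPn => [/legal //|_]; exact: legal.
suff okx n : ok (mkseq x n) by apply: win => n; have := xs n; rewrite okx.
elim: n => // n IH; rewrite mkseqS /ok all_rcons -/(ok _) IH andbT.
have := xs n; rewrite IH => xn; apply/mem_set.
by exists (sigma (mkseq x n)) => //; exact: legal.
Qed.

(** [a] translates the moves of One backwards and [b] the answers of Two
    forwards.  Markov and predetermined strategies translate because [a] and [b]
    depend only on the round; strategies with memory translate by replaying the
    history. *)
Lemma game_le_translation T T' (P Q : set (set T)) (P' Q' : set (set T'))
    (a : nat -> set T' -> set T) (b : nat -> set T' -> T -> T') :
  (forall n p, P' p -> P (a n p)) ->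
  (forall n p x, P' p -> a n p x -> p (b n p x)) ->
  (forall (p : nat -> set T') (x : nat -> T),
     (forall n, P' (p n)) -> (forall n, a n (p n) (x n)) ->
     Q (range x) -> Q' (range (fun n => b n (p n) (x n)))) ->
  game_le (G1 P Q) (G1 P' Q').
Proof.
move=> aP bp abQ; split.
- move=> [tau [/= legal win]]; exists (fun p n => b n p (tau (a n p) n)).
  split=> /= [p n pP|p pP]; first by apply: bp => //; apply: legal; exact: aP.
  apply: (abQ p (fun n => tau (a n (p n)) n)) => // [n|].
    by apply: legal; exact: aP.
  by apply: (win (fun n => a n (p n))) => n; exact: aP.
- move=> [tau [/= legal win]].
  (* The history of [H], with every move translated into a move of [G]. *)
  pose tr (s : seq (set T')) := mkseq (fun i => a i (nth set0 s i)) (size s).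
  have tr_mkseq p n : tr (mkseq p n) = mkseq (fun i => a i (p i)) n.
    rewrite /tr size_mkseq; apply/eq_in_map => i.
    rewrite mem_iota add0n => /andP[_ ilt].
    by rewrite nth_mkseq.
  have tr_rcons s p : tr (rcons s p) = rcons (tr s) (a (size s) p).
    rewrite /tr size_rcons mkseqS nth_rcons ltnn eqxx; congr rcons.
    apply/eq_in_map => i; rewrite mem_iota add0n => /andP[_ ilt].
    by rewrite nth_rcons ilt.
  have trP s : all (fun q => q \in P') s -> all (fun q => q \in P) (tr s).
    elim/last_ind: s => // s p IH; rewrite all_rcons => /andP[/set_mem pP sP].
    by rewrite tr_rcons all_rcons IH// andbT; exact/mem_set/aP.
  exists (fun s => b (size s).-1 (last set0 s) (tau (tr s))).
  split=> /= [s p sP pP|p pP].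
    rewrite last_rcons size_rcons /= tr_rcons; apply: bp => //.
    by apply: legal; [exact: trP|exact: aP].
  pose x n := tau (mkseq (fun i => a i (p i)) n.+1).
  have -> : (fun n => b (size (mkseq p n.+1)).-1 (last set0 (mkseq p n.+1))
      (tau (tr (mkseq p n.+1)))) = fun n => b n (p n) (x n).
    by apply/funext => n; rewrite tr_mkseq size_mkseq (mkseqS p) last_rcons.
  apply: (abQ p x) => // [n|]; last by apply: win => n; exact: aP.
  rewrite /x mkseqS; apply: legal; last exact: aP.
  by apply/allP => _ /mapP[i _ ->]; exact/mem_set/aP.
- move=> /I_wins_total[sigma legal win]; apply/I_wins_total.
  pose tr := transcript (fun acc => b (size acc) (sigma acc)).
  exists (fun s => a (size s) (sigma (tr s))) => [s|x xa]; first exact: aP.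
  pose y n := b n (sigma (tr (mkseq x n))) (x n).
  have trE n : tr (mkseq x n) = mkseq y n.
    rewrite /tr transcript_mkseq; apply/eq_map => i.
    by rewrite size_transcript size_mkseq.
  have xa' n : a n (sigma (tr (mkseq x n))) (x n).
    by have := xa n; rewrite size_mkseq.
  move=> /(abQ (fun n => sigma (tr (mkseq x n))) x (fun=> legal _) xa').
  by apply: win => n; rewrite -trE; exact: bp.
- move=> [p [/= pP win]]; exists (fun n => a n (p n)).
  split=> /= [n|x xa /(abQ p x pP xa)]; first exact: aP.
  by apply: win => n; exact: bp.
Qed.

Lemma game_le_fewer_moves T (P P' Q : set (set T)) :
  P' `<=` P -> game_le (G1 P Q) (G1 P' Q).
Proof.
move=> sub.
by apply: (@game_le_translation _ _ _ _ _ _ (fun=> id) (fun _ _ => id)) => // n p /sub.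
Qed.

(** Two answers [m] with a point that lies both in [m] and in the set that the
    strategy of One would play in the other game. *)
Lemma II_wins_of_meeting T (P M Q : set (set T)) :
  M !=set0 -> (forall p m, P p -> M m -> p `&` m !=set0) ->
  (I_wins (G1 P Q) -> II_wins (G1 M (~` Q))) /\
  (I_pre_wins (G1 P Q) -> II_mark_wins (G1 M (~` Q))).
Proof.
move=> [m0 Mm0] meet.
have pickP : P !=set0 -> exists f : set T -> set T -> T,
    forall p m, P p -> M m -> (p `&` m) (f p m).
  move=> [p0 Pp0]; have [x0 _] := meet _ _ Pp0 Mm0.
  have /choice[f fP] : forall pm : set T * set T, exists x : T,
      P pm.1 -> M pm.2 -> (pm.1 `&` pm.2) x.
    move=> [p m] /=; have [[Pp Mm]|nPM] := pselect (P p /\ M m).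
      by have [x] := meet _ _ Pp Mm; exists x.
    by exists x0 => Pp Mm; case: nPM.
  by exists (fun p m => f (p, m)) => p m; exact: (fP (p, m)).
split=> [/I_wins_total[sigma legal win]|[p [/= pP win]]].
  have [f fP] := pickP (ex_intro _ _ (legal [::])).
  pose tr := transcript (fun acc m => f (sigma acc) m).
  have [x0 _] := meet _ _ (legal [::]) Mm0.
  exists (fun s => last x0 (tr s)); split=> /= [s m sM Mm|m mM].
    by rewrite /tr transcript_rcons last_rcons; have [] := fP _ m (legal (tr s)) Mm.
  pose x n := f (sigma (tr (mkseq m n))) (m n).
  have trE n : tr (mkseq m n) = mkseq x n by rewrite /tr transcript_mkseq.
  rewrite (_ : (fun n => _) = x); last first.
    by apply/funext => n; rewrite trE mkseqS last_rcons.
  by apply: win => n; rewrite -trE; have [] := fP _ _ (legal (tr (mkseq m n))) (mM n).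
have [f fP] := pickP (ex_intro _ _ (pP 0%N)).
exists (fun m n => f (p n) m); split=> /= [m n Mm|m mM].
  by have [] := fP _ _ (pP n) Mm.
by apply: win => n; have [] := fP _ _ (pP n) (mM n).
Qed.

(** After any history, the answers of Two to the possible next moves [m] form
    the range of a choice function on [M].  One plays a member of [P] inside
    that range, so that every answer of the opponent is the answer of Two to
    some [m], which is taken as the next move of the history. *)
Lemma I_wins_of_selection T (P M Q : set (set T)) :
  M !=set0 ->
  (forall f : set T -> T, (forall m, M m -> m (f m)) ->
     exists2 p, P p & p `<=` f @` M) ->
  (II_wins (G1 M Q) -> I_wins (G1 P (~` Q))) /\
  (II_mark_wins (G1 M Q) -> I_pre_wins (G1 P (~` Q))).
Proof.
move=> [m0 Mm0] sel; split=> [[tau [/= legal win]]|[tau [/= legal win]]].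
  have /choice[g gP] : forall sx : seq (set T) * T, exists m,
      M m /\ ((exists2 m, M m & tau (rcons sx.1 m) = sx.2) ->
             tau (rcons sx.1 m) = sx.2).
    move=> [s x] /=; have [[m Mm taum]|no] :=
      pselect (exists2 m, M m & tau (rcons s m) = x); first by exists m.
    by exists m0.
  pose tr := transcript (fun s x => g (s, x)).
  have trM s : all (fun q => q \in M) (tr s).
    elim/last_ind: s => // s x IH.
    rewrite /tr transcript_rcons all_rcons IH andbT.
    by apply/mem_set; case: (gP (tr s, x)).
  have /choice[sigma sigmaP] : forall s : seq T, exists p,
      P p /\ p `<=` (fun m => tau (rcons (tr s) m)) @` M.
    move=> s; have [m|p] := sel (fun m => tau (rcons (tr s) m)).
      exact: legal.
    by exists p.
  apply/I_wins_total; exists sigma => [s|x xs]; first by case: (sigmaP s).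
  rewrite /setC /= notK.
  pose m n := g (tr (mkseq x n), x n).
  have trE n : tr (mkseq x n) = mkseq m n by rewrite /tr transcript_mkseq.
  rewrite (_ : x = fun n => tau (mkseq m n.+1)); last first.
    apply/funext => n; rewrite mkseqS -trE.
    have [_ ->//] := gP (tr (mkseq x n), x n).
    by have [_ sub] := sigmaP (mkseq x n); exact: sub (xs n).
  by apply: win => n; case: (gP (tr (mkseq x n), x n)).
have /choice[p pP] : forall n, exists p, P p /\ p `<=` (tau^~ n) @` M.
  by move=> n; have [m|p] := sel (tau^~ n); [exact: legal|exists p].
exists p; split=> /= [n|x xp]; first by case: (pP n).
rewrite /setC /= notK.
have /choice[m mP] : forall n, exists m, M m /\ tau m n = x n.
  by move=> n; have [_ sub] := pP n; have [m] := sub _ (xp n); exists m.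
rewrite (_ : x = fun n => tau (m n) n); last first.
  by apply/funext => n; case: (mP n).
by apply: win => n; case: (mP n).
Qed.

(** Each of the four equivalences follows in one direction from [P] and [M]
    meeting and in the other from a selection principle.  The principle for
    choice functions on [P] is a consequence of the one for choice functions on
    [M]: if no member of [M] lay in the range of such an [f], then choosing in
    every [m] a point off this range would produce a member [p] of [P] without
    [f p]. *)
Lemma dual_of_selection T (P M Q : set (set T)) :
  M !=set0 -> (forall m, M m -> m !=set0) ->
  (forall p m, P p -> M m -> p `&` m !=set0) ->
  (forall f : set T -> T, (forall m, M m -> m (f m)) -> P (f @` M)) ->
  game_dual (G1 P Q) (G1 M (~` Q)).
Proof.
move=> Mn0 mn0 meet sel.
have [f0 f0M] : exists f : set T -> T, forall m, M m -> m (f m).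
  have [m0 /mn0[x0 _]] := Mn0.
  have /choice[f fP] : forall m : set T, exists x, M m -> m x.
    by move=> m; have [/mn0[x]|] := pselect (M m); [exists x|exists x0].
  by exists f.
have Pn0 : P !=set0 by exists (f0 @` M); exact: sel.
have meet' m p : M m -> P p -> m `&` p !=set0.
  by move=> Mm Pp; rewrite setIC; exact: meet.
have selM (f : set T -> T) : (forall m, M m -> m (f m)) ->
    exists2 p, P p & p `<=` f @` M by move=> /sel; exists (f @` M).
have selP (f : set T -> T) : (forall p, P p -> p (f p)) ->
    exists2 m, M m & m `<=` f @` P.
  move=> fP; apply: contrapT => no.
  have /choice[h hP] : forall m : set T, exists x, M m -> m x /\ ~ (f @` P) x.
    move=> m; have [Mm|nMm] := pselect (M m); last by exists (f0 m).
    apply: contrapT => nox; apply: no; exists m => // x mx.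
    by apply: contrapT => nfx; apply: nox; exists x.
  have Ph : P (h @` M) by apply: sel => m /hP[].
  have [m Mm hm] := fP _ Ph.
  by have [_] := hP _ Mm; rewrite hm; apply; exists (h @` M).
have [IQ preQ] := II_wins_of_meeting Q Mn0 meet.
have [IQ' preQ'] := II_wins_of_meeting (~` Q) Pn0 meet'.
have [IIQ markQ] := I_wins_of_selection Q Pn0 selP.
have [IIQ' markQ'] := I_wins_of_selection (~` Q) Mn0 selM.
by rewrite setCK in IQ' preQ' IIQ' markQ'; split; split.
Qed.

(** * Dual pairs of families *)

Lemma dense_Omega (Z : topologicalType) (z : Z) :
  @dense_sets Z `<=` Omega_pt z.
Proof.
move=> S dS B; rewrite nbhsE => -[G [oG Gz] GB].
have [y [Gy Sy]] := dS _ (ex_intro _ z Gz) oG.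
by exists y; split=> //; exact: GB.
Qed.

Lemma proper_nbhs_of_nbhs (Z : topologicalType) (z y : Z) (N : set Z) :
  nbhs z N -> ~ N y -> proper_nbhs_pt z !=set0.
Proof.
rewrite nbhsE => -[G [oG Gz] GN] nNy; exists G; split=> //; split=> //.
  by exists z.
by move=> GT; apply: nNy; apply: GN; rewrite GT.
Qed.

Lemma proper_nbhs_proper (Z : topologicalType) (z : Z) :
  proper_nbhs_pt z !=set0 -> @proper_opens Z !=set0.
Proof. by move=> [W [pW _]]; exists W. Qed.

Section TopologicalDuality.
Variable Z : topologicalType.
Implicit Types (z : Z) (Q : set (set Z)).

Lemma proper_opensI (O W : set Z) :
  open O -> proper_opens W -> O `&` W !=set0 -> proper_opens (O `&` W).
Proof.
move=> oO [oW _ WT] OW; split=> //; first exact: openI.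
by move=> OWT; apply: WT; apply/seteqP; split=> // y _;
  have := (I : [set: Z] y); rewrite -OWT => -[].
Qed.

Lemma dual_Omega z Q : proper_nbhs_pt z !=set0 ->
  game_dual (G1 (Omega_pt z) Q) (G1 (proper_nbhs_pt z) (~` Q)).
Proof.
move=> zn0; have [W [pW Wz]] := zn0; apply: dual_of_selection => //.
- by move=> m [_ mz]; exists z.
- by move=> S m Sz [[om _ _] mz]; apply: Sz; exact: open_nbhs_nbhs.
- move=> f fM B; rewrite nbhsE => -[G [oG Gz] GB].
  have OWM : proper_nbhs_pt z (G `&` W).
    by split=> //; apply: proper_opensI => //; exists z.
  exists (f (G `&` W)); split; first by exists (G `&` W).
  by apply: GB; have [] := fM _ OWM.
Qed.

Lemma dual_dense Q : @proper_opens Z !=set0 ->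
  game_dual (G1 (@dense_sets Z) Q) (G1 (@proper_opens Z) (~` Q)).
Proof.
move=> zn0; have [W pW] := zn0; apply: dual_of_selection => //.
- by move=> m [].
- by move=> S m dS [om mn0 _]; rewrite setIC; exact: dS.
- move=> f fM O On0 oO.
  (* The whole space is not a move, but every chosen point lies in it. *)
  have [OT|OT] := pselect (O = setT).
    by exists (f W); rewrite OT; split=> //; exists W.
  by exists (f O); split; [exact: fM|exists O].
Qed.

End TopologicalDuality.

Section CoverDuality.
Variables (X : topologicalType) (AA : closed_ideal X).

(** Deleting a point outside [A], which is closed, makes a neighbourhood of
    [A] proper. *)
Lemma ideal_proper_nbhs A U : ideal_mem AA A -> open U -> A `<=` U ->
  exists2 W, proper_nbhs_set A W & W `<=` U.
Proof.
move=> AAA oU AU; have [x nAx] : exists x, ~ A x.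
  apply: contrapT => no; apply: (@ideal_neqT _ AA).
  rewrite (_ : setT = A)//; apply/seteqP; split=> // y _.
  by apply: contrapT => nAy; apply: no; exists y.
have AW : A `<=` U `&` ~` [set x].
  by move=> y Ay; split; [exact: AU|move=> /= yx; apply: nAx; rewrite -yx].
exists (U `&` ~` [set x]); last by move=> y [].
split=> //; split.
- by apply: openI => //; apply: closed_openC; apply: ideal_closed (ideal1 AA x).
- by have [y Ay] := ideal_neq0 AAA; exists y; exact: AW.
- by move=> UT; have := (I : [set: X] x); rewrite -UT => -[_ /(_ erefl)].
Qed.

Lemma proper_ideal_cover (UU : set (set X)) : UU `<=` @proper_opens X ->
  (forall A, ideal_mem AA A -> exists2 U, UU U & A `<=` U) ->
  ideal_covers (ideal_mem AA) UU.
Proof.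
move=> UUo cov; split=> //.
- by move=> U /UUo[].
- apply/seteqP; split=> // x _; have [U UUU xU] := cov _ (ideal1 AA x).
  by exists U => //; exact: xU.
- by move=> /UUo[_ [x]].
- by move=> /UUo[].
Qed.

Lemma ideal_cover_proper (UU : set (set X)) :
  ideal_covers (ideal_mem AA) UU -> UU `<=` @proper_opens X.
Proof.
move=> [UUo _ n0 nT _] U UUU; split; [exact: UUo| |by move=> UT; rewrite -UT in nT].
by apply: contrapT => /nonemptyPn U0; rewrite -U0 in n0.
Qed.

Lemma dual_covers (Q : set (set (set X))) :
  game_dual (G1 (ideal_covers (ideal_mem AA)) Q)
    (G1 (proper_nbhs_fam (ideal_mem AA)) (~` Q)).
Proof.
have nbn0 A : ideal_mem AA A -> proper_nbhs_set A !=set0.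
  by move=> AAA; have [W] := ideal_proper_nbhs AAA openT (@subsetT _ A); exists W.
apply: dual_of_selection.
- by have [A AAA] := ideal_nonempty AA; exists (proper_nbhs_set A), A.
- by move=> _ [A AAA <-]; exact: nbn0.
- move=> UU _ UUc [A AAA <-]; have [_ _ _ _ /(_ _ AAA)[U UUU AU]] := UUc.
  by exists U; split=> //; split=> //; exact: (ideal_cover_proper UUc).
- move=> f fM; apply: proper_ideal_cover.
    by move=> _ [_ [A AAA <-] <-]; have [] := fM _ (ex_intro2 _ _ A AAA erefl).
  move=> A AAA; exists (f (proper_nbhs_set A)).
    by exists (proper_nbhs_set A) => //; exists A.
  by have [] := fM _ (ex_intro2 _ _ A AAA erefl).
Qed.

(** For each [n < N] pick a point outside [W n]: a member of the ideal together
    with these points can only be caught at an index [n >= N]. *)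
Lemma ideal_cover_infinitely_often (W : nat -> set X) N A :
  ideal_covers (ideal_mem AA) (range W) -> ideal_mem AA A ->
  exists2 n, (N <= n)%N & A `<=` W n.
Proof.
move=> Wc; have [_ _ _ WnT cov] := Wc; elim: N A => [|N IH] A AAA.
  by have [_ [n _ <-] AW] := cov _ AAA; exists n.
have [x nWx] : exists x, ~ W N x.
  apply: contrapT => no; apply: WnT; exists N => //; apply/seteqP; split=> // y _.
  by apply: contrapT => nWy; apply: no; exists y.
have [n Nn AW] := IH _ (idealU AAA (ideal1 AA x)).
exists n; last by move=> y Ay; apply: AW; left.
rewrite ltn_neqAle Nn andbT; apply/eqP => Nn'.
by apply: nWx; rewrite Nn'; apply: AW; right.
Qed.

End CoverDuality.

(** * From covers to function spaces and back *)

(** [F] stands for either function space, and [small e f x] for the statement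
    that the values of [f] at [x] have absolute value less than [e]. *)
Section FunctionFamily.
Local Open Scope ring_scope.
Variables (R : realType) (X : topologicalType) (F : Type) (f0 : F).
Variable small : R -> F -> X -> Prop.
Hypothesis open_small : forall e f, open [set x | small e f x].
Hypothesis small_le : forall e d f x, e <= d -> small e f x -> small d f x.

(** The sets of which 0 is an adherent point in the topology of uniform
    convergence on the members of [AA]. *)
Definition adheres0 (AA : set (set X)) : set (set F) :=
  [set S | forall A e, AA A -> 0 < e ->
    exists2 f, S f & forall x, A x -> small e f x].

(** The set on which a function is small may be the whole space, which no cover
    contains; One therefore plays all proper open subsets of such sets.  The
    bound [1 / (n + 1)] has to shrink with the round, as an answer keeps no
    other record of how small the function is. *)
Lemma covers_le_adheres0 (AA BB : closed_ideal X) :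
  game_le (G1 (ideal_covers (ideal_mem AA)) (ideal_covers (ideal_mem BB)))
    (G1 (adheres0 (ideal_mem AA)) (adheres0 (ideal_mem BB))).
Proof.
pose tiny n (W : set X) f := forall x, W x -> small n.+1%:R^-1 f x.
pose a n (S : set F) := [set W | proper_opens W /\ exists2 f, S f & tiny n W f].
have /choice[b bP] : forall nSW : nat * set F * set X, exists f,
    a nSW.1.1 nSW.1.2 nSW.2 -> nSW.1.2 f /\ tiny nSW.1.1 nSW.2 f.
  move=> [[n S] W] /=; have [[pW [f Sf Wf]]|no] := pselect (a n S W); last first.
    by exists f0.
  by exists f.
have e_gt0 n : 0 < n.+1%:R^-1 :> R by rewrite invr_gt0 ltr0n.
apply: (@game_le_translation _ _ _ _ _ _ a (fun n S W => b (n, S, W))).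
- move=> n S Sacc; apply: proper_ideal_cover => [W []//|A AAA].
  have [f Sf fA] := Sacc _ _ AAA (e_gt0 n).
  have [W [pW AW] Wf] := ideal_proper_nbhs AAA (open_small _ f) fA.
  by exists W => //; split=> //; exists f.
- by move=> n S W _ /(bP (n, S, W))[].
- move=> S W Sacc aW Wc A e BBA e0.
  have [N Ne] : exists N : nat, N.+1%:R^-1 < e.
    by have [N] := ltr_add_invr e0; rewrite add0r; exists N.
  have [n Nn AW] := ideal_cover_infinitely_often N Wc BBA.
  exists (b (n, S n, W n)); first by exists n.
  move=> x /AW Wx; have [_ /(_ x Wx)] := bP (n, S n, W n) (aW n).
  apply: small_le; apply: le_trans (ltW Ne).
  by rewrite lef_pV2 ?posrE ?ltr0n// ler_nat.
Qed.

Lemma dense_le_covers (AA BB : closed_ideal X) (D : set (set F)) :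
  (forall UU, ideal_covers (ideal_mem AA) UU ->
     D [set f | exists2 U, UU U & forall x, ~ U x -> ~ small 1 f x]) ->
  game_le (G1 D (adheres0 (ideal_mem BB)))
    (G1 (ideal_covers (ideal_mem AA)) (ideal_covers (ideal_mem BB))).
Proof.
move=> UUD; pose big (f : F) (U : set X) := forall x, ~ U x -> ~ small 1 f x.
pose a (n : nat) (UU : set (set X)) := [set f | exists2 U, UU U & big f U].
have /choice[b bP] : forall UUf : set (set X) * F, exists U,
    a 0%N UUf.1 UUf.2 -> UUf.1 U /\ big UUf.2 U.
  move=> [UU f] /=; have [[U UUU fU]|no] := pselect (a 0%N UU f); last by exists set0.
  by exists U.
apply: (@game_le_translation _ _ _ _ _ _ a (fun _ UU f => b (UU, f))).
- by move=> n UU /UUD.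
- by move=> _ UU f _ /(bP (UU, f))[].
- move=> UU f UUc af facc; apply: proper_ideal_cover.
    move=> _ [n _ <-]; apply: (ideal_cover_proper (UUc n)).
    by case: (bP (UU n, f n) (af n)).
  move=> B BBB; have [_ [n _ <-] fB] := facc _ _ BBB ltr01.
  exists (b (UU n, f n)); first by exists n.
  move=> x Bx; apply: contrapT => nbx.
  by have [_ /(_ x nbx)] := bP (UU n, f n) (af n); apply; exact: fB.
Qed.

Lemma covers_equiv (AA BB : closed_ideal X) (D : set (set F)) :
  D `<=` adheres0 (ideal_mem AA) ->
  (forall UU, ideal_covers (ideal_mem AA) UU ->
     D [set f | exists2 U, UU U & forall x, ~ U x -> ~ small 1 f x]) ->
  game_equiv (G1 (ideal_covers (ideal_mem AA)) (ideal_covers (ideal_mem BB)))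
    (G1 (adheres0 (ideal_mem AA)) (adheres0 (ideal_mem BB))) /\
  game_equiv (G1 (ideal_covers (ideal_mem AA)) (ideal_covers (ideal_mem BB)))
    (G1 D (adheres0 (ideal_mem BB))).
Proof.
move=> Dacc UUD.
have le1 := covers_le_adheres0 AA BB.
have le2 := game_le_fewer_moves (adheres0 (ideal_mem BB)) Dacc.
have le3 := dense_le_covers BB UUD.
split; apply: game_le_equiv => //.
  exact: game_le_trans le2 le3.
exact: game_le_trans le1 le2.
Qed.

End FunctionFamily.

(** * Minimal usco maps *)

(** Otherwise the sets [C `\` W] generate a proper filter, and a cluster point
    of it lies in every [C] but not in [W]. *)
Lemma chain_compact_subset (T : topologicalType) (K : set (set T)) (W : set T) :
  hausdorff_space T -> K !=set0 -> total_on K subset ->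
  (forall C, K C -> compact C) -> open W -> \bigcap_(C in K) C `<=` W ->
  exists2 C, K C & C `<=` W.
Proof.
move=> hT [C0 KC0] totK cK oW capW; apply: contrapT => no.
have FF : ProperFilter (filter_from K (fun C => C `\` W)).
  apply: filter_from_proper.
    apply: filter_from_filter; first by exists C0.
    move=> C D KC KD; have [CD|DC] := totK _ _ KC KD.
      by exists C => // y [Cy nWy]; split; split=> //; exact: CD.
    by exists D => // y [Dy nWy]; split; split=> //; exact: DC.
  move=> C KC; apply: contrapT => /nonemptyPn CW; apply: no; exists C => // y Cy.
  by apply: contrapT => nWy; have : (C `\` W) y by []; rewrite CW.
have [|p [_ clp]] := cK _ KC0 (filter_from K (fun C => C `\` W)) _.
  by exists C0 => // y [].
have pK C : K C -> (C `\` W) p.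
  move=> KC; have : closed (C `\` W).
    rewrite setDE; apply: closedI; last exact: open_closedC.
    by apply: compact_closed => //; exact: cK.
  apply=> B; apply: clp; first by exists C.
have [_] := pK _ KC0; apply; apply: capW => C KC.
by have [] := pK _ KC.
Qed.

Section Usco.
Local Open Scope ring_scope.
Variables (R : realType) (X : topologicalType).
Implicit Types (Phi Psi Theta : X -> set R).

Lemma usco_chain_bigcap (F : set (X -> set R)) : F !=set0 ->
  F `<=` @usco R X ->
  total_on F (fun Phi Psi => forall x, Phi x `<=` Psi x) ->
  usco (fun x => \bigcap_(Phi in F) Phi x).
Proof.
move=> [Phi0 FPhi0] Fu totF.
have cF Phi x : F Phi -> compact (Phi x) by move=> /Fu[/(_ x)[]].
have subset_of x (W : set R) : open W -> \bigcap_(Phi in F) Phi x `<=` W ->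
    exists2 Phi, F Phi & Phi x `<=` W.
  move=> oW sub.
  have [|||||_ [Phi FPhi <-]] := @chain_compact_subset R
    [set Phi x | Phi in F] W (@Rhausdorff R).
  - by exists (Phi0 x), Phi0.
  - move=> _ _ [Phi FPhi <-] [Psi FPsi <-].
    by have [h|h] := totF _ _ FPhi FPsi; [left|right]; exact: h.
  - by move=> _ [Phi FPhi <-]; exact: cF.
  - by [].

  - by move=> y yF; apply: sub => Phi FPhi; apply: yF; exists Phi.
  - by exists Phi.
split=> [x|W oW]; first split.
- apply: contrapT => /nonemptyPn F0.
  have [||Phi /Fu[/(_ x)[[y Phiy] _] _] /(_ y Phiy)] // := subset_of x set0.
  by rewrite F0.
- apply: (subclosed_compact _ (cF _ x FPhi0)); last by move=> y; exact.
  apply: closed_bigI => Phi FPhi; apply: compact_closed; last exact: cF.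
  exact: Rhausdorff.
- rewrite openE => x /= /(subset_of _ _ oW)[Phi FPhi PhiW].
  have oPhi : open [set x | Phi x `<=` W] by have [_] := Fu _ FPhi; exact.
  rewrite /interior; apply: filterS (open_nbhs_nbhs (conj oPhi PhiW)) => y yW.
  by apply: subset_trans yW => z; exact.
Qed.

(** By Zorn's lemma, chains of usco maps being bounded below by their
    intersection. *)
Lemma minimal_usco_below Theta : usco Theta ->
  exists2 Psi, minimal_usco Psi & forall x, Psi x `<=` Theta x.
Proof.
move=> uT.
pose below Psi := usco Psi /\ forall x, Psi x `<=` Theta x.
pose le (s t : {Psi | below Psi}) := `[< forall x, sval t x `<=` sval s x >].
have bT : below Theta by split=> // x y.
have [|||[Psi [uPsi PsiT]] minPsi] := @ZL_preorder _ (exist _ Theta bT) le.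
- by move=> s; apply/asboolP => x y.
- move=> r s t /asboolP rs /asboolP st; apply/asboolP => x.
  exact: subset_trans (st x) (rs x).
- move=> A totA; have [[s As]|/nonemptyPn ->] := pselect (A !=set0); last first.
    by exists (exist _ Theta bT).
  pose F : set (X -> set R) := sval @` A.
  have bF : below (fun x => \bigcap_(Phi in F) Phi x).
    split; last first.
      move=> x y yF; have [_] := svalP s; apply.
      by apply: yF; exists s.
    apply: usco_chain_bigcap.
    - by exists (sval s), s.
    - by move=> _ [t _ <-]; case: (svalP t).
    - move=> _ _ [t At <-] [u Au <-].
      by have [/asboolP|/asboolP] := totA _ _ At Au; [right|left].
  exists (exist _ _ bF) => t At; apply/asboolP => x y /= yF.
  by apply: yF; exists t.
- exists Psi => //; split=> // Phi uPhi sub.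
  have bPhi : below Phi.
    by split=> // x y Phiy; exact: (PsiT x y (sub (x, y) Phiy)).
  have /asboolP PsiPhi : le (exist _ Phi bPhi) (exist _ Psi (conj uPsi PsiT)).
    by apply: minPsi; apply/asboolP => x y Phiy; exact: (sub (x, y)).
  by apply/seteqP; split=> // -[x y]; exact: PsiPhi.
Qed.

(** [Theta], which is [Phi] on [V], [c] off the closure of [V], and both on the
    boundary, is an usco map; take [Psi] minimal below it.  The minimality of
    [Phi] forces [Psi] and [Phi] to agree on [V], while [Psi] has only the value
    [c] available off the closure. *)
Lemma minimal_usco_glue Phi (V : set X) (c : R) : minimal_usco Phi -> open V ->
  exists Psi, [/\ minimal_usco Psi, forall x, V x -> Psi x = Phi x &
                  forall x, ~ closure V x -> Psi x = [set c]].
Proof.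
move=> [[Phi1 Phi2] minPhi] oV.
pose Theta x := [set y | closure V x /\ Phi x y \/ ~ V x /\ y = c].
have ThetaV x : V x -> Theta x = Phi x.
  move=> Vx; apply/seteqP; split=> y; first by case=> -[].
  by left; split=> //; exact: subset_closure.
have ThetaC x : ~ closure V x -> Theta x = [set c].
  move=> nVx; apply/seteqP; split=> y; first by case=> -[].
  by move=> ->; right; split=> // Vx; apply: nVx; exact: subset_closure.
have ThetaB x : closure V x -> ~ V x -> Theta x = Phi x `|` [set c].
  move=> cVx nVx; apply/seteqP; split=> y; first by case=> -[]; [left|right].
  by case; [left|right].
have uTheta : usco Theta.
  split=> [x|W oW].
    have [cVx|/ThetaC ->] := pselect (closure V x); last first.
      by split; [exists c|exact: compact_set1].
    have [[y Phiy] cPhi] := Phi1 x.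
    split; first by exists y; left.
    have [/ThetaV -> //|nVx] := pselect (V x).
    by rewrite ThetaB//; apply: compactU => //; exact: compact_set1.
  have [Wc|nWc] := pselect (W c).
    rewrite (_ : mkset _ = [set x | Phi x `<=` W] `|` ~` closure V).
      by apply: openU; [exact: Phi2|apply: closed_openC; exact: closed_closure].
    apply/seteqP; split=> x.
      move=> ThW; have [cVx|] := pselect (closure V x); last by right.
      by left=> y Phiy; apply: ThW; left.
    by case=> [PhiW y [[_ /PhiW]|[_ ->]]//|/ThetaC /= -> _ ->].
  rewrite (_ : mkset _ = V `&` [set x | Phi x `<=` W]).
    by apply: openI => //; exact: Phi2.
  apply/seteqP; split=> x /=.
    move=> ThW; have Vx : V x.
      by apply: contrapT => nVx; apply: nWc; apply: ThW; right.
    by split=> //; rewrite -(ThetaV _ Vx).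
  by move=> [Vx PhiW]; rewrite ThetaV.
have [Psi mPsi PsiT] := minimal_usco_below uTheta.
have [[Psi1 Psi2] _] := mPsi.
exists Psi; split=> // [x Vx|x nVx]; last first.
  have := PsiT x; rewrite ThetaC// => sub; apply/seteqP; split=> // y ->.
  by have [[z Psiz] _] := Psi1 x; rewrite -(sub z Psiz).
have PsiV z : V z -> Psi z `<=` Phi z by move=> /ThetaV <-; exact: PsiT.
(* [Psi] on [V] and [Phi] elsewhere is an usco map below [Phi], hence is
   [Phi] itself. *)
pose Phi' z := [set y | V z /\ Psi z y \/ ~ V z /\ Phi z y].
have Phi'V z : V z -> Phi' z = Psi z.
  move=> Vz; apply/seteqP; split=> y; first by case=> -[].
  by left.
have Phi'C z : ~ V z -> Phi' z = Phi z.
  move=> nVz; apply/seteqP; split=> y; first by case=> -[].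
  by right.
have Phi'Phi z : Phi' z `<=` Phi z.
  by have [Vz|/Phi'C ->//] := pselect (V z); rewrite Phi'V//; exact: PsiV.
have uPhi' : usco Phi'.
  split=> [z|W oW].
    by have [/Phi'V ->|/Phi'C ->] := pselect (V z).
  rewrite (_ : mkset _ = [set z | Phi z `<=` W] `|` V `&` [set z | Psi z `<=` W]).
    by apply: openU; [exact: Phi2|apply: openI => //; exact: Psi2].
  apply/seteqP; split=> z /=.
    by have [/[dup] Vz /Phi'V ->|/Phi'C ->] := pselect (V z); [right|left].
  case=> [|[/Phi'V -> //]].
  by apply: subset_trans; exact: Phi'Phi.
have grE := minPhi _ uPhi' (fun zy => @Phi'Phi zy.1 zy.2).
rewrite -(Phi'V _ Vx); apply/seteqP; split=> y; first exact: Phi'Phi.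
by rewrite -[Phi x y]/(graph Phi (x, y)) -grE.
Qed.

End Usco.

Lemma MU_glue (R : realType) (X : topologicalType) (Phi : MU R X) (V : set X)
    (c : R) : open V ->
  exists Psi : MU R X, (forall x, V x -> Psi x = Phi x) /\
                       (forall x, ~ closure V x -> Psi x = [set c]).
Proof.
move=> oV; have [Psi [mPsi PsiV PsiC]] := minimal_usco_glue c (MU_minimal Phi) oV.
by exists (MkMU mPsi).
Qed.

(** * The space of minimal usco maps *)

Section MUSpace.
Local Open Scope ring_scope.
Variables (R : realType) (X : topologicalType).
Implicit Types (Phi Psi : MU R X) (A : set X) (e : R).

Definition MU_small e Phi (x : X) := Phi x `<=` [set y | `|y| < e].

Lemma open_MU_small e Phi : open [set x | MU_small e Phi x].
Proof.
have [[_ uPhi] _] := MU_minimal Phi; apply: uPhi.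
have := @open_comp R R Num.norm [set y | y < e].
apply=> [y _|]; [exact: norm_continuous|exact: open_lt].
Qed.

Lemma MU_small_le e d Phi x : e <= d -> MU_small e Phi x -> MU_small d Phi x.
Proof. by move=> ed sm y /sm /= /lt_le_trans; exact. Qed.

Lemma MU_ball0 A e Psi : MU_ball MU0 A e Psi <-> forall x, A x -> MU_small e Psi x.
Proof.
split=> [sm x Ax y Psiy|sm x Ax].
  by have [_ /(_ y Psiy)[_ ->]] := sm x Ax; rewrite subr0.
split=> [_ ->|y Psiy]; last by exists 0 => //; rewrite subr0; exact: sm Psiy.
have [[/(_ x)[[y Psiy] _] _] _] := MU_minimal Psi.
by exists y => //; rewrite sub0r normrN; exact: sm Psiy.
Qed.

Lemma MU_ball_triangle Phi Psi Xi A e d :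
  MU_ball Phi A e Psi -> MU_ball Psi A d Xi -> MU_ball Phi A (e + d) Xi.
Proof.
move=> PhiPsi PsiXi x Ax.
have [fg gf] := PhiPsi x Ax; have [gh hg] := PsiXi x Ax.
split=> y.
  move=> /fg[z /gh[w Xiw zw] yz]; exists w => //.
  by rewrite -(subrKA z); apply: le_lt_trans (ler_normD _ _) _; exact: ltrD.
move=> /hg[z /gf[w Phiw zw] yz]; exists w => //.
rewrite -(subrKA z) addrC; apply: le_lt_trans (ler_normD _ _) _.
by rewrite addrC (addrC e); apply: ltrD.
Qed.

Section Topology.
Variable AA : closed_ideal X.

(** The ball itself need not be open, since the distance to [Phi] may approach
    [e] on [A]; the union of the balls of radius less than [e] is. *)
Lemma MU_ball_nbhs (Phi : MU_on R AA) A e : ideal_mem AA A -> 0 < e ->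
  nbhs Phi (MU_ball Phi A e : set (MU_on R AA)).
Proof.
move=> AAA e0; rewrite nbhsE.
exists [set Psi | exists2 d, d < e & MU_ball Phi A d Psi]; last first.
  move=> Psi [d de PhiPsi] x Ax; have [fg gf] := PhiPsi x Ax.
  by split=> y => [/fg|/gf][z ? ?]; exists z => //; exact: lt_trans de.
split; last first.
  exists (e / 2); first by rewrite ltr_pdivrMr// ltr_pMr// ltr1n.
  by move=> x _; split=> y Phiy; exists y => //; rewrite subrr normr0 divr_gt0.
rewrite MU_openE => Psi [d de PhiPsi]; exists A, ((e - d) / 2); split=> //.
  by rewrite divr_gt0// subr_gt0.
move=> Xi PsiXi; exists (d + (e - d) / 2); first lra.
exact: MU_ball_triangle PsiXi.
Qed.

Lemma MU_nbhsP (Phi : MU_on R AA) (N : set (MU_on R AA)) :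
  nbhs Phi N ->
  exists A e, [/\ ideal_mem AA A, 0 < e & MU_ball Phi A e `<=` N].
Proof.
rewrite nbhsE => -[G [oG Gf] GN].
have [A [e [AAA e0 sub]]] : exists A e,
  [/\ ideal_mem AA A, 0 < e & MU_ball Phi A e `<=` G] by exact: oG.
by exists A, e; split=> //; exact: subset_trans GN.
Qed.

Lemma MU_OmegaE :
  @Omega_pt (MU_on R AA) MU0 = adheres0 MU_small (ideal_mem AA).
Proof.
apply/seteqP; split=> S.
  move=> clS A e AAA e0.
  have [Psi [SPsi /MU_ball0 sm]] := clS _ (MU_ball_nbhs MU0 AAA e0).
  by exists Psi.
move=> acc N /MU_nbhsP[A [e [AAA e0 sub]]].
have [Psi SPsi sm] := acc _ _ AAA e0.
by exists Psi; split=> //; apply: sub; exact/MU_ball0.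
Qed.

Lemma MU_proper_nbhs : @proper_nbhs_pt (MU_on R AA) MU0 !=set0.
Proof.
have [A AAA] := ideal_nonempty AA; have [x Ax] := ideal_neq0 AAA.
(* Gluing along the empty set yields the constant map 1. *)
have [One [_ One1]] := MU_glue (@MU0 R X) 1 (@open0 X).
apply: (@proper_nbhs_of_nbhs (MU_on R AA) MU0 One _ (MU_ball_nbhs MU0 AAA ltr01)).
move=> /MU_ball0/(_ x Ax); rewrite /MU_small One1 ?closure0//.
by move=> /(_ 1 erefl) /=; rewrite normr1 ltxx.
Qed.

Lemma MU_dense_big (UU : set (set X)) : ideal_normal AA ->
  ideal_covers (ideal_mem AA) UU ->
  @dense_sets (MU_on R AA)
    [set Psi | exists2 U, UU U & forall x, ~ U x -> ~ MU_small 1 Psi x].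
Proof.
move=> nAA [oUU _ _ _ cov] G [Phi GPhi] oG.
have [A [e [AAA e0 sub]]] := MU_nbhsP (open_nbhs_nbhs (conj oG GPhi)).
have [U UUU AU] := cov _ AAA.
have [V [oV AV _ VU]] := nAA _ _ AAA (oUU _ UUU) AU.
have [Psi [PsiV PsiC]] := MU_glue Phi 1 oV.
exists Psi; split.
  apply: sub => x /AV/PsiV ->.
  by split=> y Phiy; exists y => //; rewrite subrr normr0.
exists U => // x nUx; rewrite /MU_small PsiC; last by move=> /VU.
by move=> /(_ 1 erefl) /=; rewrite normr1 ltxx.
Qed.

End Topology.

Lemma MU_games (AA BB : closed_ideal X) : ideal_normal AA ->
  game_equiv (G1 (ideal_covers (ideal_mem AA)) (ideal_covers (ideal_mem BB)))
    (G1 (@Omega_pt (MU_on R AA) MU0) (@Omega_pt (MU_on R BB) MU0)) /\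
  game_equiv (G1 (ideal_covers (ideal_mem AA)) (ideal_covers (ideal_mem BB)))
    (G1 (@dense_sets (MU_on R AA)) (@Omega_pt (MU_on R BB) MU0)).
Proof.
move=> nAA; rewrite !MU_OmegaE; apply: covers_equiv.
- exact: MU0.
- exact: open_MU_small.
- exact: MU_small_le.
- by rewrite -MU_OmegaE; exact: dense_Omega.
- by move=> UU; exact: MU_dense_big.
Qed.

End MUSpace.

(** * The space of continuous functions *)

Section CSpace.
Local Open Scope ring_scope.
Variables (R : realType) (X : topologicalType).
Implicit Types (f g : continuousType X R) (A : set X) (e : R).

Definition C_small e f (x : X) : Prop := `|f x| < e.

Lemma open_C_small e f : open [set x | C_small e f x].
Proof.
have := @open_comp X R (fun x => `|f x|) [set y | y < e].
apply=> [x _|]; last exact: open_lt.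
apply: (@continuous_comp _ _ _ f Num.norm); last exact: norm_continuous.
exact: cts_fun.
Qed.

Lemma C_small_le e d f x : e <= d -> C_small e f x -> C_small d f x.
Proof. by move=> ed /lt_le_trans; exact. Qed.

Section Topology.
Variable AA : closed_ideal X.

Lemma C_ball_nbhs f A e : ideal_mem AA A -> 0 < e ->
  nbhs (f : C_on R AA)
    ([set g | forall x, A x -> `|f x - g x| < e] : set (C_on R AA)).
Proof. by move=> AAA e0; apply/C_nbhsP; exists A, e; split=> // g. Qed.

Lemma C_OmegaE :
  @Omega_pt (C_on R AA) C0 = adheres0 C_small (ideal_mem AA).
Proof.
apply/seteqP; split=> S.
  move=> clS A e AAA e0; have [g [Sg sm]] := clS _ (C_ball_nbhs C0 AAA e0).
  by exists g => // x /sm; rewrite sub0r normrN.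
move=> acc N /C_nbhsP[A [e [AAA e0 sub]]].
have [g Sg sm] := acc _ _ AAA e0.
by exists g; split=> //; apply: sub => x /sm; rewrite sub0r normrN.
Qed.

Lemma C_proper_nbhs : @proper_nbhs_pt (C_on R AA) C0 !=set0.
Proof.
have [A AAA] := ideal_nonempty AA; have [x Ax] := ideal_neq0 AAA.
pose one : continuousType X R := [the continuousType X R of cst 1].
apply: (@proper_nbhs_of_nbhs (C_on R AA) C0 one _ (C_ball_nbhs C0 AAA ltr01)).
by move=> /(_ x Ax) /=; rewrite sub0r normrN normr1 ltxx.
Qed.

Lemma C_dense_big (UU : set (set X)) : functionally_ideal_normal R AA ->
  ideal_covers (ideal_mem AA) UU ->
  @dense_sets (C_on R AA)
    [set g | exists2 U, UU U & forall x, ~ U x -> ~ C_small 1 g x].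
Proof.
move=> nAA [oUU _ _ _ cov] G [f Gf] oG.
have [A [e [AAA e0 sub]]] := (C_nbhsP _ _).1 (open_nbhs_nbhs (conj oG Gf)).
have [U UUU AU] := cov _ AAA.
have [h [ch hA hU]] := nAA _ _ AAA (oUU _ UUU) AU.
have h0 x : A x -> h x = 0.
  by move=> Ax; have : [set 0] (h x) by rewrite -hA; exists x.
pose k x : R := (f : continuousType X R) x * (1 - h x) + h x.
have ck : continuous k.
  move=> x; apply: cvgD; last exact: ch.
  apply: cvgM; first exact: cts_fun.
  by apply: cvgB; [exact: cvg_cst|exact: ch].
pose g : continuousType X R := [the continuousType X R of mkcts ck].
have gE x : g x = k x by [].
exists g; split.
  by apply: sub => x Ax /=; rewrite gE /k (h0 _ Ax) subr0 mulr1 addr0 subrr normr0.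
exists U => // x nUx; rewrite /C_small gE /k hU//.
by rewrite subrr mulr0 add0r normr1 ltxx.
Qed.

End Topology.

Lemma C_games (AA BB : closed_ideal X) : functionally_ideal_normal R AA ->
  game_equiv (G1 (ideal_covers (ideal_mem AA)) (ideal_covers (ideal_mem BB)))
    (G1 (@Omega_pt (C_on R AA) C0) (@Omega_pt (C_on R BB) C0)) /\
  game_equiv (G1 (ideal_covers (ideal_mem AA)) (ideal_covers (ideal_mem BB)))
    (G1 (@dense_sets (C_on R AA)) (@Omega_pt (C_on R BB) C0)).
Proof.
move=> nAA; rewrite !C_OmegaE; apply: covers_equiv.
- exact: C0.
- exact: open_C_small.
- exact: C_small_le.
- by rewrite -C_OmegaE; exact: dense_Omega.
- by move=> UU; exact: C_dense_big.
Qed.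

Lemma functionally_normal_normal (AA : closed_ideal X) :
  functionally_ideal_normal R AA -> ideal_normal AA.
Proof.
move=> nAA A U AAA oU AU; have [h [ch hA hU]] := nAA A U AAA oU AU.
exists [set x | h x < 1 / 2]; split.
- apply: (@open_comp _ _ h [set y | y < 1 / 2]) => [x _|].
    exact: ch.
  exact: open_lt.
- move=> x Ax /=; have -> : h x = 0.
    by have : [set 0] (h x) by rewrite -hA; exists x.
  by rewrite divr_gt0.
- exact: subset_closure.
- apply: (@subset_trans _ [set x | h x <= 1 / 2]).
    rewrite closureE; apply: smallest_sub => [|x /ltW//].
    apply: (@preimage_closed _ _ h [set y | y <= 1 / 2]) => [x _|].
      exact: ch.
    exact: closed_le.
  move=> x /= hx; apply: contrapT => /hU hx1; move: hx; rewrite hx1; lra.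
Qed.

End CSpace.

Theorem corollary37 (R : realType) (X : topologicalType)
    (AA BB : closed_ideal X) :
  (ideal_normal AA ->
    [/\ (* the games G *)
        game_equiv
          (G1 (ideal_covers (ideal_mem AA)) (ideal_covers (ideal_mem BB)))
          (G1 (@Omega_pt (MU_on R AA) MU0) (@Omega_pt (MU_on R BB) MU0)),
        game_equiv
          (G1 (@Omega_pt (MU_on R AA) MU0) (@Omega_pt (MU_on R BB) MU0))
          (G1 (@dense_sets (MU_on R AA)) (@Omega_pt (MU_on R BB) MU0)),
        (* the games H *)
        game_equiv
          (G1 (proper_nbhs_fam (ideal_mem AA)) (~` ideal_covers (ideal_mem BB)))
          (G1 (@proper_nbhs_pt (MU_on R AA) MU0)
              (~` @Omega_pt (MU_on R BB) MU0)),
        game_equiv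
          (G1 (@proper_nbhs_pt (MU_on R AA) MU0)
              (~` @Omega_pt (MU_on R BB) MU0))
          (G1 (@proper_opens (MU_on R AA)) (~` @Omega_pt (MU_on R BB) MU0)) &
        game_dual
          (G1 (ideal_covers (ideal_mem AA)) (ideal_covers (ideal_mem BB)))
          (G1 (proper_nbhs_fam (ideal_mem AA))
              (~` ideal_covers (ideal_mem BB)))]) /\
  (functionally_ideal_normal R AA ->
    [/\ game_equiv
          (G1 (ideal_covers (ideal_mem AA)) (ideal_covers (ideal_mem BB)))
          (G1 (@Omega_pt (MU_on R AA) MU0) (@Omega_pt (MU_on R BB) MU0)),
        game_equiv
          (G1 (@Omega_pt (MU_on R AA) MU0) (@Omega_pt (MU_on R BB) MU0))
          (G1 (@Omega_pt (C_on R AA) C0) (@Omega_pt (C_on R BB) C0)),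
        game_equiv
          (G1 (@Omega_pt (C_on R AA) C0) (@Omega_pt (C_on R BB) C0))
          (G1 (@dense_sets (MU_on R AA)) (@Omega_pt (MU_on R BB) MU0)) &
        game_equiv
          (G1 (@dense_sets (MU_on R AA)) (@Omega_pt (MU_on R BB) MU0))
          (G1 (@dense_sets (C_on R AA)) (@Omega_pt (C_on R BB) C0))] /\
    [/\ game_equiv
          (G1 (proper_nbhs_fam (ideal_mem AA)) (~` ideal_covers (ideal_mem BB)))
          (G1 (@proper_nbhs_pt (MU_on R AA) MU0)
              (~` @Omega_pt (MU_on R BB) MU0)),
        game_equiv
          (G1 (@proper_nbhs_pt (MU_on R AA) MU0)
              (~` @Omega_pt (MU_on R BB) MU0))
          (G1 (@proper_nbhs_pt (C_on R AA) C0) (~` @Omega_pt (C_on R BB) C0)),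
        game_equiv
          (G1 (@proper_nbhs_pt (C_on R AA) C0) (~` @Omega_pt (C_on R BB) C0))
          (G1 (@proper_opens (MU_on R AA)) (~` @Omega_pt (MU_on R BB) MU0)) &
        game_equiv
          (G1 (@proper_opens (MU_on R AA)) (~` @Omega_pt (MU_on R BB) MU0))
          (G1 (@proper_opens (C_on R AA)) (~` @Omega_pt (C_on R BB) C0))]).
Proof.
have dcov := dual_covers AA (ideal_covers (ideal_mem BB)).
have dMU := @dual_Omega (MU_on R AA) MU0 (@Omega_pt (MU_on R BB) MU0)
  (MU_proper_nbhs R AA).
have dMUd := @dual_dense (MU_on R AA) (@Omega_pt (MU_on R BB) MU0)
  (proper_nbhs_proper (MU_proper_nbhs R AA)).
have dC := @dual_Omega (C_on R AA) C0 (@Omega_pt (C_on R BB) C0)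
  (C_proper_nbhs R AA).
have dCd := @dual_dense (C_on R AA) (@Omega_pt (C_on R BB) C0)
  (proper_nbhs_proper (C_proper_nbhs R AA)).
split=> [nAA|fAA].
  have [MUO MUD] := MU_games R BB nAA.
  have MUOD := game_equiv_trans (game_equiv_sym MUO) MUD.
  split=> //; [exact: game_equiv_dual MUO|exact: game_equiv_dual MUOD].
have [MUO MUD] := MU_games R BB (functionally_normal_normal fAA).
have [CO CD] := C_games BB fAA.
have MUCO := game_equiv_trans (game_equiv_sym MUO) CO.
have COMUD := game_equiv_trans (game_equiv_sym CO) MUD.
have MUCD := game_equiv_trans (game_equiv_sym MUD) CD.
split; split=> //.
- exact: game_equiv_dual MUO.
- exact: game_equiv_dual MUCO.
- exact: game_equiv_dual COMUD.
- exact: game_equiv_dual MUCD.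
Qed.
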